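(* Let $G$ be a Hausdorff topological group, $K$ a subgroup of $G$, and let $(X,\theta)$ and $(Y,\eta)$ be $K$-spaces. If two $K$-maps $m,n:X\to Y$ are $K$-homotopic, then the $G$-maps $G\times_Km$ and $G\times_Kn$ from $G\times_KX$ to $G\times_KY$ are $G$-homotopic. In other words, the functor $G\times_K-:\mathcal{PA}_K\to\mathcal{A}_G$ preserves homotopies. In particular (case $K=G$), the globalization functor $E:\mathcal{PA}_G\to\mathcal{A}_G$ preserves homotopies.
   Context: Partial actions. A partial action of a group $G$ (identity $e$) on a set $X$ is a map $\theta:G*X\to X$, $(g,x)\mapsto g\cdot x$, defined on a subset $G*X\subseteq G\times X$ (write $\exists\, g\cdot x$ for $(g,x)\in G*X$), such that for all $g,h\in G$, $x\in X$: (PA1) if $\exists\, g\cdot x$ then $\exists\, g^{-1}\cdot(g\cdot x)$ and $g^{-1}\cdot(g\cdot x)=x$; (PA2) if $\exists\, g\cdot(h\cdot x)$ then $\exists\,(gh)\cdot x$ and $g\cdot(h\cdot x)=(gh)\cdot x$; (PA3) $\exists\, e\cdot x$ and $e\cdot x=x$. It is global if $G*X=G\times X$. Put $X_g=\{x\in X:\exists\, g^{-1}\cdot x\}$, $\theta_g:X_{g^{-1}}\to X_g$, $x\mapsto g\cdot x$. If $G$ is a topological group and $X$ a topological space, $\theta$ is topological if every $X_g$ is open in $X$ and every $\theta_g$ is a homeomorphism, and continuous if $\theta$ is continuous for the subspace topology on $G*X\subseteq G\times X$. All topological groups are Hausdorff and all partial actions are topological. A $G$-space is a pair $(X,\theta)$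 with $\theta$ a continuous (topological) partial action of $G$ on the topological space $X$. A $G$-map $f:(X,\theta)\to(Y,\eta)$ is a continuous map such that for all $(g,x)\in G*X$ one has $(g,f(x))\in G*Y$ and $\eta(g,f(x))=f(\theta(g,x))$. $\mathcal{PA}_G$ is the category of $G$-spaces and $G$-maps, $\mathcal{A}_G$ its full subcategory of $G$-spaces with global action. Homotopies. With $I=[0,1]$ carrying the trivial global action, $X\times I$ is a $G$-space via the diagonal partial action: $(g,(x,t))\in G*(X\times I)$ iff $(g,x)\in G*X$, and then $g\cdot(x,t)=(g\cdot x,t)$. $G$-maps $m,n:X\to Y$ are $G$-homotopic if there is a $G$-map $H:X\times I\to Y$ with $H(\cdot,0)=m$ and $H(\cdot,1)=n$. Twisted product. For a subgroup $K\le G$ (subspace topology) and a $K$-space $(X,\theta)$, $G\times_KX$ is the quotient space of $G\times X$ by the equivalence relation whose classes are $[g,x]_K=\{(gk^{-1},\theta(k,x)):k\in K^x\}$, where $K^x=\{k\in K:(k,x)\in K*X\}$. $G$ acts on it globally and continuously by $g'\cdot[g,x]_K=[g'g,x]_K$. For a $K$-map $f:X\to Y$, $G\times_Kf:[g,x]_K\mapsto[g,f(x)]_K$; this defines the functor $G\times_K-$. For $K=G$ it is the globalization functor $E$: $G\times_GX=X_G$ is the enveloping space $(G\times X)/R$, where $(g,x)R(h,y)$ iff $x\in X_{g^{-1}h}$ and $\theta_{h^{-1}g}(x)=y$, and $E(f)([g,x])=[g,f(x)]$. *)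

(* Defs.v *)
From HB Require Import structures.
From mathcomp Require Import all_boot all_order all_algebra generic_quotient.
From mathcomp Require Import all_classical reals topology.

Set Implicit Arguments.
Unset Strict Implicit.
Unset Printing Implicit Defensive.

Import Order.TTheory GRing.Theory Num.Theory.
Import numFieldTopology.Exports.

Local Open Scope classical_set_scope.
Local Open Scope quotient_scope.
Local Open Scope group_scope.

HB.mixin Record isTopologicalGroup G of Topological G & Group G := {
  mulg_continuous : continuous (fun p : G * G => p.1 * p.2);
  invg_continuous : continuous (fun g : G => g^-1)
}.

#[short(type="topologicalGroupType")]
HB.structure Definition TopologicalGroup :=
  {G of Topological G & Group G & isTopologicalGroup G}.

Definition subgroup_carrier (G : topologicalGroupType) (K : groupClosed G) : Type :=
  {g : G | g \in K}.

Section SubgroupInstances.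
Variables (G : topologicalGroupType) (K : groupClosed G).

Lemma subgroup_closed : group_closed K.
Proof. by split=> [|x y]; [exact: gpred1|exact: gpredF]. Qed.

HB.instance Definition _ := SubChoice.copy (subgroup_carrier K) {g : G | g \in K}.
HB.instance Definition _ :=
  SubChoice_isSubGroup.Build G (mem K) (subgroup_carrier K) subgroup_closed.
HB.instance Definition _ := Topological.copy (subgroup_carrier K)
  (initial_topology (val : subgroup_carrier K -> G)).

Lemma subgroup_val_continuous : continuous (val : subgroup_carrier K -> G).
Proof. exact: initial_continuous. Qed.

Lemma subgroup_carrier_continuous (T : topologicalType) (f : T -> subgroup_carrier K) :
  continuous (fun t => val (f t)) -> continuous f.
Proof.
move=> /continuousP cf; apply/continuousP => A [B oB <-].
exact: cf.
Qed.

Lemma subgroup_mulg_continuous :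
  continuous (fun p : subgroup_carrier K * subgroup_carrier K => p.1 * p.2).
Proof.
apply: subgroup_carrier_continuous => p.
apply: (@continuous_comp _ _ _
  (fun p : subgroup_carrier K * subgroup_carrier K => (val p.1, val p.2))
  (fun p : G * G => p.1 * p.2)); last exact: mulg_continuous.
by apply: cvg_pair; apply: continuous_comp;
  by [exact: cvg_fst|exact: cvg_snd|exact: subgroup_val_continuous].
Qed.

Lemma subgroup_invg_continuous : continuous (fun g : subgroup_carrier K => g^-1).
Proof.
apply: subgroup_carrier_continuous => g.
apply: (@continuous_comp _ _ _ (val : subgroup_carrier K -> G) (fun g : G => g^-1)).
  exact: subgroup_val_continuous.
exact: invg_continuous.
Qed.

HB.instance Definition _ := isTopologicalGroup.Build (subgroup_carrier K)
  subgroup_mulg_continuous subgroup_invg_continuous.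
End SubgroupInstances.

Section Subgroup.
Variables (G : topologicalGroupType) (K : groupClosed G).

Definition subgroup : topologicalGroupType :=
  [the topologicalGroupType of subgroup_carrier K].

Definition subgroup_incl (k : subgroup) : G := val (k : subgroup_carrier K).

Lemma subgroup_incl1 : subgroup_incl 1 = 1.
Proof. exact: (@val1 _ _ (subgroup_carrier K)). Qed.

Lemma subgroup_inclM k l :
  subgroup_incl (k * l) = subgroup_incl k * subgroup_incl l.
Proof. exact: (@valM _ _ (subgroup_carrier K)). Qed.

Lemma subgroup_inclV k : subgroup_incl k^-1 = (subgroup_incl k)^-1.
Proof.
apply: (mulgI (subgroup_incl k)).
by rewrite -subgroup_inclM !mulgV subgroup_incl1.
Qed.

Lemma subgroup_incl_continuous : continuous subgroup_incl.
Proof. exact: subgroup_val_continuous. Qed.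
End Subgroup.

(* [pa_act] is a total function whose values outside [pa_dom] are irrelevant;
   [pa_dom] is the set G * X of the pairs (g, x) such that g . x exists. *)
Record partialAction (G : groupType) (X : Type) := PartialAction {
  pa_dom : set (G * X);
  pa_act : G -> X -> X;
  pa_actK : forall g x, pa_dom (g, x) ->
    pa_dom (g^-1, pa_act g x) /\ pa_act g^-1 (pa_act g x) = x;
  pa_actM : forall g h x, pa_dom (h, x) -> pa_dom (g, pa_act h x) ->
    pa_dom (g * h, x) /\ pa_act g (pa_act h x) = pa_act (g * h) x;
  pa_act1 : forall x, pa_dom (1, x) /\ pa_act 1 x = x
}.

(* The set X_g, which is both the domain of g^-1 . _ and the image of g . _ *)
Definition pa_ran (G : groupType) (X : Type) (theta : partialAction G X)
    (g : G) : set X :=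
  [set x | pa_dom theta (g^-1, x)].

Definition pa_global (G : groupType) (X : Type) (theta : partialAction G X) :=
  pa_dom theta = setT.

Definition homeomorphism_on (T U : topologicalType) (A : set T) (B : set U)
    (f : T -> U) :=
  [/\ set_bij A B f, {within A, continuous f} &
      exists2 f' : U -> T, {within B, continuous f'} & {in A, cancel f f'}].

Definition pa_topological (G : topologicalGroupType) (X : topologicalType)
    (theta : partialAction G X) :=
  forall g : G, open (pa_ran theta g) /\
    homeomorphism_on (pa_ran theta g^-1) (pa_ran theta g) (pa_act theta g).

Definition pa_continuous (G : topologicalGroupType) (X : topologicalType)
    (theta : partialAction G X) :=
  {within pa_dom theta, continuous (fun p => pa_act theta p.1 p.2)}.

Record gspace (G : topologicalGroupType) := Gspace {
  gs_space :> topologicalType;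
  gs_action : partialAction G gs_space;
  gs_topological : pa_topological gs_action;
  gs_continuous : pa_continuous gs_action
}.

Record globalGspace (G : topologicalGroupType) := GlobalGspace {
  ggs_gspace :> gspace G;
  ggs_global : pa_global (gs_action ggs_gspace)
}.

Record gmap (G : topologicalGroupType) (X Y : gspace G) := Gmap {
  gmap_fun :> X -> Y;
  gmap_continuous : continuous gmap_fun;
  gmap_equivariant : forall g x, pa_dom (gs_action X) (g, x) ->
    pa_dom (gs_action Y) (g, gmap_fun x) /\
    pa_act (gs_action Y) g (gmap_fun x) = gmap_fun (pa_act (gs_action X) g x)
}.

Section Topology.

Lemma within_continuousM (S T U : topologicalType) (A : set S) (B : set T)
    (phi : S -> T) (f : T -> U) :
  continuous phi -> (forall s, A s -> B (phi s)) ->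
  {within B, continuous f} -> {within A, continuous (f \o phi)}.
Proof.
move=> cphi AB /subspace_continuousP cf; apply/subspace_continuousP => s As.
move=> V /(cf _ (AB _ As)) /= /cphi; rewrite !nbhs_simpl /=.
rewrite /within /=; apply: filterS => s' + As'; apply; exact: AB.
Qed.

Lemma within_continuous_pair (S T U : topologicalType) (A : set S)
    (f : S -> T) (g : S -> U) :
  {within A, continuous f} -> {within A, continuous g} ->
  {within A, continuous (fun s => (f s, g s))}.
Proof.
move=> /subspace_continuousP cf /subspace_continuousP cg.
apply/subspace_continuousP => s As.
by apply: cvg_pair; [exact: cf|exact: cg].
Qed.

End Topology.

Section PartialActionTheory.
Variables (G : topologicalGroupType) (X : topologicalType).
Variable theta : partialAction G X.

Lemma pa_act_continuous (g : G) : pa_continuous theta ->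
  {within pa_ran theta g^-1, continuous (pa_act theta g)}.
Proof.
apply: (within_continuousM (phi := fun x : X => (g, x))) => [x|x].
  by apply: cvg_pair; [exact: cvg_cst|exact: cvg_id].
by rewrite /pa_ran /= invgK.
Qed.

Lemma pa_continuous_topological : (forall g, open (pa_ran theta g)) ->
  pa_continuous theta -> pa_topological theta.
Proof.
move=> oX ctheta g; split=> //; split; [split| |].
- by move=> x; rewrite /pa_ran /= invgK => dx; have [] := pa_actK dx.
- move=> x y; rewrite !inE /pa_ran /= invgK => dx dy.
  have [_ xE] := pa_actK dx; have [_ yE] := pa_actK dy.
  by move=> xy; rewrite -xE xy yE.
- move=> x; rewrite /pa_ran /= => dx; have [dgx xE] := pa_actK dx.
  by rewrite invgK in dgx xE; exists (pa_act theta g^-1 x) => //=; rewrite invgK.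
- exact: pa_act_continuous.
- exists (pa_act theta g^-1).
    by have := pa_act_continuous (g := g^-1) ctheta; rewrite invgK.
  by move=> x; rewrite inE /pa_ran /= invgK => dx; have [] := pa_actK dx.
Qed.

End PartialActionTheory.

Definition unit_interval (R : realType) : topologicalType :=
  [the topologicalType of set_type [set t : R | (0 <= t <= 1)%R]].

Section UnitInterval.
Variable R : realType.

Lemma unit_interval0 : (0%R : R) \in [set t : R | (0 <= t <= 1)%R].
Proof. by rewrite inE /= lexx ler01. Qed.

Lemma unit_interval1 : (1%R : R) \in [set t : R | (0 <= t <= 1)%R].
Proof. by rewrite inE /= lexx ler01. Qed.

Definition ui0 : unit_interval R := exist _ (0%R : R) unit_interval0.
Definition ui1 : unit_interval R := exist _ (1%R : R) unit_interval1.
End UnitInterval.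

Section Cylinder.
Variables (R : realType) (G : topologicalGroupType) (X : gspace G).
Local Notation theta := (gs_action X).

Program Definition cylinder_action :
    partialAction G (X * unit_interval R) := {|
  pa_dom := [set p | pa_dom theta (p.1, p.2.1)];
  pa_act := fun g p => (pa_act theta g p.1, p.2)
|}.
Next Obligation. by move=> g [x t] /= d; have [? ->] := pa_actK d. Qed.
Next Obligation. by move=> g h [x t] /= d d'; have [? ->] := pa_actM d d'. Qed.
Next Obligation. by move=> [x t] /=; have [? ->] := pa_act1 theta x. Qed.

Lemma cylinder_continuous : pa_continuous cylinder_action.
Proof.
apply: within_continuous_pair; last first.
  apply: continuous_subspaceT => p.
  by apply: continuous_comp; exact: cvg_snd.
apply: (within_continuousM (B := pa_dom theta)
  (phi := fun p : G * (X * unit_interval R) => (p.1, p.2.1))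
  (f := fun p => pa_act theta p.1 p.2)) => //.
  move=> p; apply: cvg_pair; first exact: cvg_fst.
  by apply: continuous_comp; [exact: cvg_snd|exact: cvg_fst].
exact: gs_continuous.
Qed.

Lemma cylinder_topological : pa_topological cylinder_action.
Proof.
apply: pa_continuous_topological cylinder_continuous => g.
have [oX _] := gs_topological X g.
by apply: (open_comp _ oX) => p _; exact: cvg_fst.
Qed.

Definition cylinder : gspace G :=
  Gspace cylinder_topological cylinder_continuous.
End Cylinder.

Definition ghomotopic (R : realType) (G : topologicalGroupType)
    (X Y : gspace G) (m n : gmap X Y) :=
  exists H : gmap (cylinder R X) Y,
    (forall x, H (x, ui0 R) = m x) /\ (forall x, H (x, ui1 R) = n x).

(* A quotient of G * X by an equivalence relation that is invariant under left
   translations of G and for which the saturation of an open set is open. *)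
Section OpenQuotient.
Variables (G : topologicalGroupType) (X : topologicalType).
Variable e : equiv_rel (G * X).
Hypothesis eM : forall h p q, e p q -> e (h * p.1, p.2) (h * q.1, q.2).
Hypothesis e_open : forall A : set (G * X), open A ->
  open [set q | exists2 p, A p & e p q].

Local Notation Q := (quotient_topology {eq_quot e}).

Definition quotient_act (g : G) (q : Q) : Q :=
  \pi_Q (g * (repr q).1, (repr q).2).

Lemma quotient_pi_eq p q : e p q -> \pi_Q p = \pi_Q q.
Proof. by move=> epq; apply/eqquotP. Qed.

Lemma quotient_repr p : e p (repr (\pi_Q p)).
Proof. by apply/(@eqquotP _ e {eq_quot e}); rewrite reprK. Qed.

Lemma quotient_actE g p : quotient_act g (\pi_Q p) = \pi_Q (g * p.1, p.2).
Proof.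
apply: quotient_pi_eq; apply: (eM g (p := repr (\pi_Q p))).
by rewrite equiv_sym; exact: quotient_repr.
Qed.

Lemma quotient_act1 q : quotient_act 1 q = q.
Proof. by rewrite /quotient_act mul1g -surjective_pairing reprK. Qed.

Lemma quotient_actM g h q :
  quotient_act g (quotient_act h q) = quotient_act (g * h) q.
Proof. by rewrite [quotient_act h q]/quotient_act quotient_actE /= mulgA. Qed.

Lemma quotient_pi_open (A : set (G * X)) : open A -> open (\pi_Q @` A).
Proof.
move=> /e_open oA.
suff E : \pi_Q @^-1` (\pi_Q @` A) = [set q | exists2 p, A p & e p q].
  by rewrite -E in oA.
apply/seteqP; split=> q /=.
  by move=> [p Ap /(@eqquotP _ e {eq_quot e}) epq]; exists p.
by move=> [p Ap epq]; exists p => //; exact: quotient_pi_eq.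
Qed.

Lemma quotient_act_continuous :
  continuous (fun p : G * Q => quotient_act p.1 p.2).
Proof.
move=> [g q] W; rewrite nbhs_simpl /= => nW.
pose f (r : G * (G * X)) : Q := \pi_Q (r.1 * r.2.1, r.2.2).
have cf : continuous f.
  move=> r; apply: (@continuous_comp _ _ _
    (fun r : G * (G * X) => (r.1 * r.2.1, r.2.2)) (\pi_Q : G * X -> Q));
    last exact: pi_continuous.
  apply: cvg_pair; last by apply: continuous_comp; exact: cvg_snd.
  apply: (@continuous_comp _ _ _
    (fun r : G * (G * X) => (r.1, r.2.1)) (fun p : G * G => p.1 * p.2));
    last exact: mulg_continuous.
  apply: cvg_pair; first exact: cvg_fst.
  by apply: continuous_comp; [exact: cvg_snd|exact: cvg_fst].
have /cf : nbhs (f (g, repr q)) W by [].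
move=> [[U V] /= [nU]]; rewrite nbhsE => -[V' [oV' V'q] V'V] UVW.
exists (U, \pi_Q @` V').
  split=> //=; have oV := quotient_pi_open oV'.
  by apply: (open_nbhs_nbhs (conj oV _)); exists (repr q) => //; rewrite reprK.
move=> [h _] /= [Uh [p V'p <-]]; rewrite quotient_actE.
by apply: (UVW (h, p)); split=> //; exact: V'V.
Qed.

Program Definition quotient_action : partialAction G Q := {|
  pa_dom := setT;
  pa_act := quotient_act
|}.
Next Obligation.
by move=> g q _; rewrite quotient_actM mulVg quotient_act1.
Qed.
Next Obligation. by move=> g h q _ _; rewrite quotient_actM. Qed.
Next Obligation. by move=> q; rewrite quotient_act1. Qed.

Lemma quotient_action_continuous : pa_continuous quotient_action.
Proof. exact/continuous_subspaceT/quotient_act_continuous. Qed.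

Lemma quotient_action_topological : pa_topological quotient_action.
Proof.
apply: pa_continuous_topological quotient_action_continuous => g.
by rewrite /pa_ran /=; exact: openT.
Qed.

Definition quotient_gspace : globalGspace G :=
  @GlobalGspace G
    (Gspace quotient_action_topological quotient_action_continuous) erefl.
End OpenQuotient.

Section OpenQuotientMap.
Variables (G : topologicalGroupType) (X Y : topologicalType).
Variables (e : equiv_rel (G * X)) (e' : equiv_rel (G * Y)).
Variable f : X -> Y.
Hypothesis ef : forall p q, e p q -> e' (p.1, f p.2) (q.1, f q.2).
Hypothesis cf : continuous f.
Local Notation Q := (quotient_topology {eq_quot e}).
Local Notation Q' := (quotient_topology {eq_quot e'}).

Definition quotient_map (q : Q) : Q' := \pi_Q' ((repr q).1, f (repr q).2).

Lemma quotient_mapE p : quotient_map (\pi_Q p) = \pi_Q' (p.1, f p.2).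
Proof.
apply: quotient_pi_eq; apply: (ef (p := repr (\pi_Q p))).
by rewrite equiv_sym; exact: quotient_repr.
Qed.

Lemma quotient_map_continuous : continuous quotient_map.
Proof.
apply/quotient_continuous.
rewrite (_ : _ \o _ = \pi_Q' \o (fun p => (p.1, f p.2))); last first.
  by apply/funext => p /=; rewrite quotient_mapE.
move=> p; apply: continuous_comp; last exact: pi_continuous.
apply: cvg_pair; first exact: cvg_fst.
by apply: continuous_comp; [exact: cvg_snd|exact: cf].
Qed.

Lemma quotient_map_act g q : (forall h p q, e p q ->
    e (h * p.1, p.2) (h * q.1, q.2)) -> (forall h p q, e' p q ->
    e' (h * p.1, p.2) (h * q.1, q.2)) ->
  quotient_act g (quotient_map q) = quotient_map (quotient_act g q).
Proof. by move=> eM e'M; rewrite quotient_actE //= quotient_mapE. Qed.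
End OpenQuotientMap.

Lemma translate_open (G H : topologicalGroupType) (X : gspace H) (k : H) (a : G)
    (A : set (G * X)) : open A ->
  open [set q | pa_ran (gs_action X) k q.2 /\
                A (q.1 * a, pa_act (gs_action X) k^-1 q.2)].
Proof.
move=> oA; set B := [set q : G * X | pa_ran (gs_action X) k q.2].
have oB : open B.
  have [oX _] := gs_topological X k.
  by apply: (open_comp _ oX) => p _; exact: cvg_snd.
pose f (q : G * X) := (q.1 * a, pa_act (gs_action X) k^-1 q.2).
have /(continuous_inP _ oB)/(_ _ oA) : {in B, continuous f}; last by [].
rewrite -continuous_open_subspace //; apply: within_continuous_pair.
  apply: continuous_subspaceT => q; apply: (@continuous_comp _ _ _
    (fun q : G * X => (q.1, a)) (fun p : G * G => p.1 * p.2));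
    last exact: mulg_continuous.
  by apply: cvg_pair; [exact: cvg_fst|exact: cvg_cst].
apply: (within_continuousM (phi := snd) (B := pa_ran (gs_action X) k)) => //.
  by move=> q; exact: cvg_snd.
by have := pa_act_continuous (g := k^-1) (@gs_continuous _ X); rewrite invgK.
Qed.

Section TwistedProduct.
Variables (G : topologicalGroupType) (K : groupClosed G).
Variable X : gspace (subgroup K).
Local Notation theta := (gs_action X).

Definition twisted_class (p : G * X) : set (G * X) :=
  [set (p.1 * (subgroup_incl k)^-1, pa_act theta k p.2) |
    k in [set k | pa_dom theta (k, p.2)]].

Definition twisted_rel (p q : G * X) : bool := q \in twisted_class p.

Lemma twisted_rel_refl : reflexive twisted_rel.
Proof.
move=> [g x]; apply/mem_set; have [d1 xE] := pa_act1 theta x.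
by exists 1 => //=; rewrite subgroup_incl1 invg1 mulg1 xE.
Qed.

Lemma twisted_relW p q : twisted_rel p q -> twisted_rel q p.
Proof.
case: p => g x /set_mem[k /= dk <-]; have [dk' xE] := pa_actK dk.
by apply/mem_set; exists k^-1 => //=; rewrite subgroup_inclV invgK mulgVK xE.
Qed.

Lemma twisted_rel_sym : symmetric twisted_rel.
Proof. by move=> p q; apply/idP/idP; exact: twisted_relW. Qed.

Lemma twisted_rel_trans : transitive twisted_rel.
Proof.
move=> q p r; case: p => g x /set_mem[k /= dk <-] /set_mem[l /= dl <-].
have [dlk E] := pa_actM dk dl.
by apply/mem_set; exists (l * k) => //=; rewrite subgroup_inclM invgM mulgA E.
Qed.

Definition twisted_equiv : equiv_rel (G * X) :=
  EquivRel twisted_rel twisted_rel_refl twisted_rel_sym twisted_rel_trans.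

Lemma twisted_equivM h p q :
  twisted_equiv p q -> twisted_equiv (h * p.1, p.2) (h * q.1, q.2).
Proof.
by move=> /set_mem[k dk <-]; apply/mem_set; exists k => //=; rewrite mulgA.
Qed.

Lemma twisted_equiv_open (A : set (G * X)) : open A ->
  open [set q | exists2 p, A p & twisted_equiv p q].
Proof.
move=> oA; rewrite [X in open X](_ : _ = \bigcup_(k : subgroup K)
    [set q | pa_ran theta k q.2 /\ A (q.1 * subgroup_incl k, pa_act theta k^-1 q.2)]).
  by apply: bigcup_open => k _; exact: translate_open.
apply/seteqP; split=> q.
  move=> [[g x] Ap /set_mem[k /= dk <-]]; exists k => //=.
  by have [dk' xE] := pa_actK dk; rewrite mulgVK xE.
move=> [k _ /= [dk Aq]]; eexists; first exact: Aq.
by apply: twisted_relW; apply/mem_set; exists k^-1 => //=; rewrite subgroup_inclV invgK.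
Qed.

Definition twisted_product : globalGspace G :=
  quotient_gspace twisted_equivM twisted_equiv_open.

Definition twisted_pi (g : G) (x : X) : twisted_product :=
  \pi_(quotient_topology {eq_quot twisted_equiv}) (g, x).

Lemma twisted_piP g x h y :
  twisted_pi g x = twisted_pi h y <-> twisted_class (g, x) (h, y).
Proof.
split=> [/eqquotP/set_mem //|xy].
by apply: quotient_pi_eq; apply/mem_set.
Qed.

Lemma twisted_actE h g x :
  pa_act (gs_action twisted_product) h (twisted_pi g x) = twisted_pi (h * g) x.
Proof. exact: (quotient_actE twisted_equivM h (g, x)). Qed.
End TwistedProduct.

Section TwistedMap.
Variables (G : topologicalGroupType) (K : groupClosed G).
Variables (X Y : gspace (subgroup K)) (f : gmap X Y).

Lemma twisted_map_rel p q : twisted_equiv X p q ->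
  twisted_equiv Y (p.1, f p.2) (q.1, f q.2).
Proof.
move=> /set_mem[k dk <-]; apply/mem_set.
by have [dk' E] := gmap_equivariant f dk; exists k => //=; rewrite E.
Qed.

(* [g, x] |-> [g, f x], see [twisted_mapE] *)
Definition twisted_map : gmap (twisted_product X) (twisted_product Y) :=
  @Gmap G (twisted_product X) (twisted_product Y)
    (@quotient_map _ _ _ (twisted_equiv X) (twisted_equiv Y) f)
    (quotient_map_continuous twisted_map_rel (@gmap_continuous _ _ _ f))
    (fun g q _ => conj I (quotient_map_act twisted_map_rel g q
       (@twisted_equivM _ _ X) (@twisted_equivM _ _ Y))).

Lemma twisted_mapE g x : twisted_map (twisted_pi g x) = twisted_pi g (f x : Y).
Proof. exact: (quotient_mapE twisted_map_rel (g, x)). Qed.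
End TwistedMap.

Section Globalization.
Variables (G : topologicalGroupType) (X : gspace G).
Local Notation theta := (gs_action X).

Definition enveloping_rel (p q : G * X) : bool :=
  `[< pa_ran theta (p.1^-1 * q.1) p.2 /\
      pa_act theta (q.1^-1 * p.1) p.2 = q.2 >].

Lemma enveloping_relP p q : reflect
  (exists2 k, pa_dom theta (k, p.2) & q = (p.1 * k^-1, pa_act theta k p.2))
  (enveloping_rel p q).
Proof.
case: p q => [g x] [h y]; rewrite /enveloping_rel; apply: (iffP (asboolP _)) => /=.
  rewrite /pa_ran /= invgM invgK => -[d <-]; exists (h^-1 * g) => //.
  by rewrite invgM invgK mulgA mulgV mul1g.
move=> [k dk [-> ->]]; rewrite /pa_ran /= mulgA mulVg mul1g invgM.
by rewrite invgK -mulgA mulVg mulg1.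
Qed.

Lemma enveloping_rel_refl : reflexive enveloping_rel.
Proof.
move=> [g x]; apply/enveloping_relP; have [d1 xE] := pa_act1 theta x.
by exists 1 => //=; rewrite invg1 mulg1 xE.
Qed.

Lemma enveloping_relW p q : enveloping_rel p q -> enveloping_rel q p.
Proof.
case: p => g x /enveloping_relP[k /= dk ->]; have [dk' xE] := pa_actK dk.
by apply/enveloping_relP; exists k^-1 => //=; rewrite invgK mulgVK xE.
Qed.

Lemma enveloping_rel_sym : symmetric enveloping_rel.
Proof. by move=> p q; apply/idP/idP; exact: enveloping_relW. Qed.

Lemma enveloping_rel_trans : transitive enveloping_rel.
Proof.
move=> q [g x] r /enveloping_relP[k /= dk ->] /enveloping_relP[l /= dl ->].
have [dlk E] := pa_actM dk dl.
by apply/enveloping_relP; exists (l * k) => //=; rewrite invgM mulgA E.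
Qed.

Definition enveloping_equiv : equiv_rel (G * X) := EquivRel enveloping_rel
  enveloping_rel_refl enveloping_rel_sym enveloping_rel_trans.

Lemma enveloping_equivM h p q :
  enveloping_equiv p q -> enveloping_equiv (h * p.1, p.2) (h * q.1, q.2).
Proof.
move=> /enveloping_relP[k dk ->]; apply/enveloping_relP.
by exists k => //=; rewrite mulgA.
Qed.

Lemma enveloping_equiv_open (A : set (G * X)) : open A ->
  open [set q | exists2 p, A p & enveloping_equiv p q].
Proof.
move=> oA; rewrite [X in open X](_ : _ = \bigcup_(k : G)
    [set q | pa_ran theta k q.2 /\ A (q.1 * k, pa_act theta k^-1 q.2)]).
  by apply: bigcup_open => k _; exact: translate_open.
apply/seteqP; split=> q.
  move=> [[g x] Ap /enveloping_relP[k /= dk ->]]; exists k => //=.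
  by have [dk' xE] := pa_actK dk; rewrite mulgVK xE.
move=> [k _ /= [dk Aq]]; eexists; first exact: Aq.
apply: enveloping_relW; apply/enveloping_relP.
by exists k^-1 => //=; rewrite invgK.
Qed.

Definition enveloping_space : globalGspace G :=
  quotient_gspace enveloping_equivM enveloping_equiv_open.

Definition enveloping_pi (g : G) (x : X) : enveloping_space :=
  \pi_(quotient_topology {eq_quot enveloping_equiv}) (g, x).

Lemma enveloping_actE h g x :
  pa_act (gs_action enveloping_space) h (enveloping_pi g x) =
  enveloping_pi (h * g) x.
Proof. exact: (quotient_actE enveloping_equivM h (g, x)). Qed.
End Globalization.

Section GlobalizationMap.
Variables (G : topologicalGroupType) (X Y : gspace G) (f : gmap X Y).

Lemma enveloping_map_rel p q : enveloping_equiv X p q ->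
  enveloping_equiv Y (p.1, f p.2) (q.1, f q.2).
Proof.
move=> /enveloping_relP[k dk ->]; apply/enveloping_relP.
by have [dk' E] := gmap_equivariant f dk; exists k => //=; rewrite E.
Qed.

(* [g, x] |-> [g, f x], see [enveloping_mapE] *)
Definition enveloping_map : gmap (enveloping_space X) (enveloping_space Y) :=
  @Gmap G (enveloping_space X) (enveloping_space Y)
    (@quotient_map _ _ _ (enveloping_equiv X) (enveloping_equiv Y) f)
    (quotient_map_continuous enveloping_map_rel (@gmap_continuous _ _ _ f))
    (fun g q _ => conj I (quotient_map_act enveloping_map_rel g q
       (@enveloping_equivM _ X) (@enveloping_equivM _ Y))).

Lemma enveloping_mapE g x :
  enveloping_map (enveloping_pi g x) = enveloping_pi g (f x : Y).
Proof. exact: (quotient_mapE enveloping_map_rel (g, x)). Qed.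
End GlobalizationMap.

(* Main.v *)
(** The homotopy sends [([g, x], t)] to [[g, H (x, t)]]. It is continuous because
    the quotient map [G * X -> G x_K X] is open, hence so is its product with the
    identity of [I]. *)
Require Import Defs.
From mathcomp Require Import all_boot all_order all_algebra.
From mathcomp Require Import all_classical reals topology.
From mathcomp Require Import generic_quotient.

Local Open Scope classical_set_scope.
Local Open Scope quotient_scope.
Local Open Scope group_scope.

(** Since the action on [I] is trivial, equivariance of [H] gives [(g k^-1, H (k x, t)) = (g k^-1, k
    H (x, t))], so at each time [t] the map [(g, x) |-> (g, H (x, t))] respects the relations and
    descends to the quotients. What remains is joint continuity in the class and [t]. Saturations of
    open sets are open, being unions of translates under partial homeomorphisms with open domains,
    so neighbourhoods upstairs project to neighbourhoods. The argument is made for abstract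
    relations [e], [e'], so that [quotient_homotopy] serves both functors. *)

Section QuotientHomotopy.
Context {R : realType} {G : topologicalGroupType} {X Y : topologicalType}.
Context {e : equiv_rel (G * X)} {e' : equiv_rel (G * Y)}.
Hypothesis eM : forall h p q, e p q -> e (h * p.1, p.2) (h * q.1, q.2).
Hypothesis e'M : forall h p q, e' p q -> e' (h * p.1, p.2) (h * q.1, q.2).
Hypothesis e_open : forall A : set (G * X), open A ->
  open [set q | exists2 p, A p & e p q].
Hypothesis e'_open : forall A : set (G * Y), open A ->
  open [set q | exists2 p, A p & e' p q].
Variable H : X * unit_interval R -> Y.
Hypothesis cH : continuous H.
Hypothesis eH : forall t p q, e p q ->
  e' (p.1, H (p.2, t)) (q.1, H (q.2, t)).
Local Notation Q := (quotient_topology {eq_quot e}).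
Local Notation Q' := (quotient_topology {eq_quot e'}).

Definition quotient_homotopy_fun (p : Q * unit_interval R) : Q' :=
  @quotient_map _ _ _ e e' (fun x => H (x, p.2)) p.1.

Lemma quotient_homotopy_funE p t :
  quotient_homotopy_fun (\pi_Q p, t) = \pi_Q' (p.1, H (p.2, t)).
Proof. exact: (quotient_mapE (eH t)). Qed.

Lemma quotient_homotopy_fun_continuous : continuous quotient_homotopy_fun.
Proof.
move=> [q t] W; rewrite nbhs_simpl /= => nW.
(* The homotopy before passing to classes in the source; its continuity is immediate from [cH]. *)
pose f (r : (G * X) * unit_interval R) : Q' := \pi_Q' (r.1.1, H (r.1.2, r.2)).
have cf : continuous f.
  move=> r; apply: (@continuous_comp _ _ _
    (fun r : (G * X) * unit_interval R => (r.1.1, H (r.1.2, r.2)))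
    (\pi_Q' : G * Y -> Q')); last exact: pi_continuous.
  apply: cvg_pair; first by apply: continuous_comp; exact: cvg_fst.
  apply: (@continuous_comp _ _ _
    (fun r : (G * X) * unit_interval R => (r.1.2, r.2)) H); last exact: cH.
  apply: (@cvg_pair _ _ _ (nbhs r) (nbhs r.1.2) (nbhs r.2) _ _ _
    (fun r => r.1.2) snd); last exact: cvg_snd.
  by apply: continuous_comp; [exact: cvg_fst|exact: cvg_snd].
have /cf : nbhs (f (repr q, t)) W by [].
(* [U] is shrunk to an open [U'] so that its image under [\pi_Q] is open. *)
move=> [[U V] /= [nU nV] UVW]; move: nU; rewrite nbhsE => -[U' [oU' U'q] U'U].
exists (\pi_Q @` U', V).
  split=> //=; have oU := quotient_pi_open e_open oU'.
  by apply: (open_nbhs_nbhs (conj oU _)); exists (repr q) => //; rewrite reprK.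
move=> [_ s] /= [[p U'p <-] Vs]; rewrite quotient_homotopy_funE.
by apply: (UVW (p, s)); split=> //; exact: U'U.
Qed.

Definition quotient_homotopy :
    gmap (cylinder R (quotient_gspace eM e_open))
      (quotient_gspace e'M e'_open) :=
  @Gmap G (cylinder R (quotient_gspace eM e_open))
    (quotient_gspace e'M e'_open) quotient_homotopy_fun
    quotient_homotopy_fun_continuous
    (fun g p _ => conj I (quotient_map_act (eH p.2) g p.1 eM e'M)).

End QuotientHomotopy.

Theorem proposition4p5 (R : realType) (G : topologicalGroupType)
    (hG : hausdorff_space G) :
  (forall (K : groupClosed G) (X Y : gspace (subgroup K)) (m n : gmap X Y),
     ghomotopic R m n -> ghomotopic R (twisted_map m) (twisted_map n)) /\
  (forall (X Y : gspace G) (m n : gmap X Y),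
     ghomotopic R m n -> ghomotopic R (enveloping_map m) (enveloping_map n)).
Proof.
split=> [K X Y m n [H [H0 H1]]|X Y m n [H [H0 H1]]].
  have eH t p q : twisted_equiv X p q ->
      twisted_equiv Y (p.1, H (p.2, t)) (q.1, H (q.2, t)).
    move=> /set_mem[k dk <-]; apply/mem_set.
    (* The domain of the cylinder action ignores [t], so [dk] applies as it is, and the same [k]
       relates the images. *)
    have [dk' E] := @gmap_equivariant _ _ _ H k (p.2, t) dk.
    by exists k => //=; rewrite E.
  exists (quotient_homotopy (@twisted_equivM _ _ X) (@twisted_equivM _ _ Y)
    (@twisted_equiv_open _ _ X) (@twisted_equiv_open _ _ Y) _
    (@gmap_continuous _ _ _ H) eH).
  (* Both sides are computed at the same representative [repr q], so [H0] and [H1] suffice. *)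
  by split=> q; congr (\pi_(quotient_topology {eq_quot _}) (_, _)).
have eH t p q : enveloping_equiv X p q ->
    enveloping_equiv Y (p.1, H (p.2, t)) (q.1, H (q.2, t)).
  move=> /enveloping_relP[k dk ->]; apply/enveloping_relP.
  have [dk' E] := @gmap_equivariant _ _ _ H k (p.2, t) dk.
  by exists k => //=; rewrite E.
exists (quotient_homotopy (@enveloping_equivM _ X) (@enveloping_equivM _ Y)
  (@enveloping_equiv_open _ X) (@enveloping_equiv_open _ Y) _
  (@gmap_continuous _ _ _ H) eH).
by split=> q; congr (\pi_(quotient_topology {eq_quot _}) (_, _)).
Qed.
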